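(* Let $(V,\langle\cdot,\cdot\rangle)$ be an inner product space with induced metric $d(u,v)=\|u-v\|$. Let $y,z,q,p\in V$ and let $\tau\in\mathcal S_0$. Then $$\tau(d(y,q))-\tau(d(y,p))-\tau(d(z,q))+\tau(d(z,p))\le \tau(d(q,p))+\tau(d(y,z)).$$
   Context: $\mathcal S$ is the set of nondecreasing, convex functions $\tau\colon[0,\infty)\to\mathbb R$ that are differentiable on $(0,\infty)$ with concave derivative $\tau'$. $\mathcal S_0:=\{\tau\in\mathcal S:\tau(0)=0\}$. *)

(* Defs.v *)
From HB Require Import structures.
From mathcomp Require Import all_boot all_order all_algebra.
From mathcomp Require Import all_classical all_reals all_analysis.
From mathcomp Require Import complex.

Set Implicit Arguments.
Unset Strict Implicit.
Unset Printing Implicit Defensive.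

Import Order.TTheory GRing.Theory Num.Theory.
Import numFieldNormedType.Exports.

Local Open Scope classical_set_scope.
Local Open Scope ring_scope.

(* A function on [0, +oo[ is represented by a total function R -> R whose
   values on ]-oo, 0[ are irrelevant: no condition below depends on them.
   In particular differentiability is only required on ]0, +oo[, and convexity
   and monotonicity include the endpoint 0. *)
Definition classS (R : realType) : set (R -> R) :=
  [set tau : R -> R |
    [/\ {in `[0, +oo[ &, {homo tau : x y / x <= y}},
        convex_function (`[0, +oo[%classic : set R) tau,
        {in `]0, +oo[, forall x, derivable tau x 1} &
        convex_function (`]0, +oo[%classic : set R) (fun x : R => - derive1 tau x)]].

Definition classS0 (R : realType) : set (R -> R) :=
  [set tau : R -> R | classS tau /\ tau 0 = 0].

(* The scalar field K is R or R[i], theta its conjugation (idfun on R), and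
   re : K -> R the real part (id on R). As dot w w is real for every w,
   re only transports it from K to R. *)
Definition dot_norm (R : realType) (K : numFieldType) (re : K -> R)
    (theta : K -> K) (V : lmodType K) (dot : {dot V for theta}) (w : V) : R :=
  Num.sqrt (re (dot w w)).

Definition dot_dist (R : realType) (K : numFieldType) (re : K -> R)
    (theta : K -> K) (V : lmodType K) (dot : {dot V for theta}) (u v : V) : R :=
  dot_norm re dot (u - v).

(* Main.v *)
Require Import Defs.
From HB Require Import structures.
From mathcomp Require Import all_boot all_order all_algebra.
From mathcomp Require Import all_classical all_reals all_analysis.
From mathcomp Require Import complex.
From mathcomp Require Import ring lra.

Set Implicit Arguments.
Unset Strict Implicit.
Unset Printing Implicit Defensive.

Import Order.TTheory GRing.Theory Num.Theory.
Import numFieldNormedType.Exports.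

Local Open Scope classical_set_scope.
Local Open Scope ring_scope.


(** Written with all signs positive, the claim says that the two diagonals
    [yq], [pz] of the closed quadrilateral [y p q z] satisfy
    [tau |yq| + tau |pz| <= tau |yp| + tau |pq| + tau |qz| + tau |zy|].

    The first idea is that it suffices to treat four points on a line.  Since
    [tau'] is nonnegative and concave on the open half line, [tau' x / x] is
    nonincreasing, hence [x |-> tau (sqrt x)] is concave and nondecreasing
    ([classS_sqrt_concave]).  Take the closest points [O1], [O2] of the two
    lines carrying the diagonals ([closest_points]), and let [s a], [(s - 1) a]
    and [t e], [(t - 1) e] be the coordinates of the end points of the
    diagonals from [O1] and [O2], where [a], [e] are the lengths of the
    diagonals.  By the law of cosines the square of a side joining coordinates
    [m a] and [n e] is [|O1 - O2|^2 + (m a)^2 + (n e)^2 - 2 m n g], where [g]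
    is the inner product of the two diagonals.  Rotating one diagonal about the
    common perpendicular changes [g] between [- a e] and [a e] and leaves the
    diagonals alone, while each [tau (side)] is a concave function of [g].  So
    the right-hand side is at least a convex combination of its values at
    [g = a e] and [g = - a e], where the two lines are parallel; dropping
    [|O1 - O2|] then puts the four points on one line and only shortens the
    sides ([four_point_gram]).

    On the line ([four_point_line]) the outcome depends on how the two
    diagonals overlap.  If they are disjoint, monotonicity is enough; if they
    overlap partially, convexity is.  If one contains the other, with gaps [u],
    [v] on the two sides of the inner one of length [x], the claim is
    [tau (x + u + v) - tau (x + u) - tau (x + v) + tau x <= tau u + tau v].
    The left-hand side is nonincreasing in [x] because [tau'] is concave, so
    one may take [x = 0], and then
    [tau (u + v) <= (tau (2 u) + tau (2 v)) / 2 <= 2 tau u + 2 tau v]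
    ([classS0_outer_le_inner]). *)

(** * Functions of the class S *)

Lemma le_of_small_slack (R : realFieldType) (a b k e : R) :
  0 < e -> (forall x, 0 < x -> x < e -> a <= b + x * k) -> a <= b.
Proof.
move=> e0 H; rewrite leNgt; apply/negP => ba.
pose d := (a - b) / (`|k| + 1) / 2.
have k1 : 0 < `|k| + 1 by rewrite ltr_pwDr.
have d0 : 0 < d by rewrite !divr_gt0 // subr_gt0.
have dE : d * (`|k| + 1) * 2 = a - b by rewrite /d; field; rewrite gt_eqF.
have m0 : 0 < Num.min d (e / 2) by rewrite lt_min d0 divr_gt0.
have me : Num.min d (e / 2) < e by rewrite gt_min; apply/orP; right; lra.
have md : Num.min d (e / 2) <= d by rewrite ge_min lexx.
have := H _ m0 me; set x := Num.min _ _ in m0 md * => h.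
have kk : k <= `|k| by apply: ler_norm.
nra.
Qed.

Lemma classS_le (R : realType) (tau : R -> R) (x y : R) :
  classS tau -> 0 <= x -> x <= y -> tau x <= tau y.
Proof.
case=> h _ _ _ x0 xy; apply: h => //; rewrite in_itv/= andbT //.
exact: le_trans xy.
Qed.

Lemma classS_convex (R : realType) (tau : R -> R) (t x y : R) :
  classS tau -> 0 <= t <= 1 -> 0 <= x -> 0 <= y ->
  tau (t * x + (1 - t) * y) <= t * tau x + (1 - t) * tau y.
Proof.
case=> _ h _ _ t01 x0 y0.
have := h (@Itv01 R t (andP t01).1 (andP t01).2) x y.
rewrite !inE /= !in_itv /= !andbT => /(_ x0 y0).
by rewrite !convRE.
Qed.

Lemma classS_derive_concave (R : realType) (tau : R -> R) (t x y : R) :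
  classS tau -> 0 <= t <= 1 -> 0 < x -> 0 < y ->
  t * derive1 tau x + (1 - t) * derive1 tau y <= derive1 tau (t * x + (1 - t) * y).
Proof.
case=> _ _ _ h t01 x0 y0.
have := h (@Itv01 R t (andP t01).1 (andP t01).2) x y.
rewrite !inE /= !in_itv /= !andbT => /(_ x0 y0).
set z := conv _ _ _; have -> : z = t * x + (1 - t) * y by [].
by rewrite !convRE /= /unstable.onem; lra.
Qed.

Lemma classS_derivable (R : realType) (tau : R -> R) (x : R) :
  classS tau -> 0 < x -> derivable tau x 1.
Proof. by case=> _ _ h _ x0; apply: h; rewrite in_itv/= x0. Qed.

Lemma classS_derive_ge0 (R : realType) (tau : R -> R) (x : R) :
  classS tau -> 0 < x -> 0 <= derive1 tau x.
Proof.
move=> S x0; apply: limr_ge.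
  under eq_fun; first (move=> h; rewrite -{2}(scaler1 h); over).
  exact: classS_derivable.
near=> h.
have h0 : h != 0 by near: h; exact: nbhs_dnbhs_neq.
have hx : `|h| < x by near: h; apply: dnbhs0_lt.
have hx0 : 0 < h + x by move: hx; rewrite ltr_norml => /andP[]; lra.
move: h0; rewrite neq_lt => /orP[h0|h0].
- rewrite nmulr_rge0 ?invr_lt0// subr_le0; apply: classS_le => //; lra.
- rewrite pmulr_rge0 ?invr_gt0// subr_ge0; apply: classS_le => //; lra.
Unshelve. all: by end_near. Qed.

(** A nonnegative concave function on the open half line is above its chord
    from the origin.  As [tau'] has no value at the origin, the chord starts at
    a small [e > 0], where [tau' e] can be dropped because it is nonnegative. *)
Lemma classS_derive_ratio (R : realType) (tau : R -> R) (x y : R) :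
  classS tau -> 0 < x -> x <= y -> x * derive1 tau y <= y * derive1 tau x.
Proof.
move=> S x0; rewrite le_eqVlt => /orP[/eqP->//|xy].
apply: (@le_of_small_slack _ _ _ (derive1 tau y - derive1 tau x) x) => // e e0 ex.
pose t := (x - e) / (y - e).
have ye : y - e != 0 by rewrite gt_eqF//; lra.
have tE : t * (y - e) = x - e by rewrite /t mulfVK.
have t01 : 0 <= t <= 1.
  by rewrite divr_ge0 ?ler_pdivrMr; lra.
have := @classS_derive_concave _ _ t y e S t01 (lt_trans x0 xy) e0.
have -> : t * y + (1 - t) * e = x by lra.
have := classS_derive_ge0 S e0.
move: t01 => /andP[t0 t1] d0 h.
have h2 : t * derive1 tau y <= derive1 tau x by nra.
have : (y - e) * (t * derive1 tau y) <= (y - e) * derive1 tau x.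
  by rewrite ler_wpM2l//; lra.
rewrite mulrA [_ * t]mulrC tE; lra.
Qed.

Lemma is_derive_derive1 (R : realType) (f : R -> R) (x df : R) :
  is_derive x 1 f df -> derive1 f x = df.
Proof. by move=> fx; rewrite derive1E derive_val. Qed.

Lemma nincr_on_pos (R : realType) (f : R -> R) (a b : R) :
  0 < a -> a <= b -> (forall x : R, 0 < x -> derivable f x 1) ->
  (forall x : R, a < x < b -> derive1 f x <= 0) -> f b <= f a.
Proof.
move=> a0 ab df f'.
apply: (@ler0_derive1_nincr _ f a b) => //.
  by move=> x; rewrite in_itv/= => /andP[ax _]; apply: df; lra.
apply: derivable_within_continuous => x; rewrite in_itv/= => /andP[ax _].
by apply: df; lra.
Qed.

(** The tangent line of [tau (sqrt _)] at [x0 ^+ 2]: with [k] its slope,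
    [tau x - k * x ^+ 2] has derivative [x * (tau' x / x - tau' x0 / x0)], so it
    is maximal at [x0] by [classS_derive_ratio]. *)
Lemma classS_tangent_parabola (R : realType) (tau : R -> R) (x x0 : R) :
  classS tau -> 0 < x0 -> 0 <= x ->
  tau x <= tau x0 + derive1 tau x0 / (2 * x0) * (x ^+ 2 - x0 ^+ 2).
Proof.
move=> S x00; set k := derive1 tau x0 / (2 * x0).
have kE : 2 * k * x0 = derive1 tau x0 by rewrite /k; field; rewrite gt_eqF.
have k0 : 0 <= k by rewrite divr_ge0 ?classS_derive_ge0//; lra.
have isd (y : R) : 0 < y ->
    is_derive y 1 (fun y : R => tau y - k * y ^+ 2) (derive1 tau y - 2 * k * y).
  move=> y0; have dt := derivableP (classS_derivable S y0).
  apply: is_derive_eq; rewrite derive1E /GRing.scale /=; ring.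
have dphi (y : R) : 0 < y ->
    derive1 (fun y : R => tau y - k * y ^+ 2) y = derive1 tau y - 2 * k * y.
  by move=> y0; apply: is_derive_derive1; exact: isd.
have main (y : R) : 0 < y -> tau y <= tau x0 + k * (y ^+ 2 - x0 ^+ 2).
  move=> y0; suff : tau y - k * y ^+ 2 <= tau x0 - k * x0 ^+ 2 by lra.
  have [xy|/ltW yx] := leP x0 y.
    apply: (@nincr_on_pos _ (fun y : R => tau y - k * y ^+ 2)) => // z.
      by move=> z0; case: (isd _ z0).
    move=> /andP[xz _]; rewrite dphi; last lra.
    have := classS_derive_ratio S x00 (ltW xz); rewrite -kE => h.
    rewrite subr_le0 -(ler_pM2l x00); apply: le_trans h _; lra.
  rewrite -lerN2.
  have isdN (z : R) : 0 < z -> is_derive z 1 (fun y : R => - (tau y - k * y ^+ 2))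
      (- (derive1 tau z - 2 * k * z)).
    by move=> z0; have := isd _ z0 => ?; apply: is_deriveN.
  apply: (@nincr_on_pos _ (fun y : R => - (tau y - k * y ^+ 2))) => // z.
    by move=> z0; case: (isdN _ z0).
  move=> /andP[yz zx]; have z0 : 0 < z by lra.
  rewrite (is_derive_derive1 (isdN _ z0)).
  have := classS_derive_ratio S z0 (ltW zx); rewrite -kE => h.
  rewrite oppr_le0 subr_ge0 -(ler_pM2l x00); apply: le_trans h; lra.
rewrite le_eqVlt => /orP[/eqP <-|]; last exact: main.
(* At 0 there is no derivative; monotonicity gives tau 0 <= tau e. *)
apply: (@le_of_small_slack _ _ _ k 1) => // e e0 e1.
have h0 : tau 0 <= tau e by apply: classS_le => //; exact: ltW.
apply: le_trans h0 _; apply: le_trans (main _ e0) _.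
have : e ^+ 2 <= e by rewrite expr2; nra.
move=> /(ler_wpM2l k0); lra.
Qed.

(** Concavity and monotonicity of [tau (sqrt _)] in one statement, free of
    square roots: average the tangent lines at the barycentre. *)
Lemma classS_sqrt_concave (R : realType) (tau : R -> R) (t a b x : R) :
  classS tau -> 0 <= t <= 1 -> 0 <= a -> 0 <= b -> 0 <= x ->
  t * a ^+ 2 + (1 - t) * b ^+ 2 <= x ^+ 2 ->
  t * tau a + (1 - t) * tau b <= tau x.
Proof.
move=> S /andP[t0 t1] a0 b0 x0 le_x.
set m := t * a ^+ 2 + (1 - t) * b ^+ 2 in le_x.
have m0 : 0 <= m by rewrite addr_ge0// mulr_ge0 ?sqr_ge0//; lra.
have sx : Num.sqrt m <= x by rewrite -(ger0_norm x0) -sqrtr_sqr ler_wsqrtr.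
apply: le_trans (classS_le S (sqrtr_ge0 m) sx).
have sm := sqr_sqrtr m0.
have := sqrtr_ge0 m; rewrite le_eqVlt => /orP[/eqP sm0|sm0].
  (* There is no tangent at 0, but then a vanishing barycentre makes every
     point of positive weight equal to 0. *)
  have : m = 0 by rewrite -sm -sm0 expr0n.
  have ta0 : 0 <= t * a ^+ 2 by rewrite mulr_ge0 ?sqr_ge0.
  have tb0 : 0 <= (1 - t) * b ^+ 2 by rewrite mulr_ge0 ?sqr_ge0//; lra.
  rewrite -sm0 /m => mE.
  have zero c y : c * y ^+ 2 = 0 -> c * tau y = c * tau 0.
    move/eqP; rewrite mulf_eq0 sqrf_eq0 => /orP[]/eqP-> //.
    by rewrite !mul0r.
  rewrite (zero t a) ?(zero (1 - t) b); lra.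
have ha := classS_tangent_parabola S sm0 a0.
have hb := classS_tangent_parabola S sm0 b0.
rewrite sm in ha hb; set k := _ / _ in ha hb.
have := lerD (ler_wpM2l t0 ha) (@ler_wpM2l _ (1 - t) _ _ _ hb).
rewrite subr_ge0 t1 => /(_ isT) h; apply: le_trans h _.
suff : k * (m - t * a ^+ 2 - (1 - t) * b ^+ 2) = 0 by lra.
by rewrite /m; ring.
Qed.

Lemma classS0_double (R : realType) (tau : R -> R) (x : R) :
  classS0 tau -> 0 <= x -> tau (2 * x) <= 4 * tau x.
Proof.
move=> [S tau0] x0.
have q : 0 <= (4^-1 : R) <= 1 by lra.
have := @classS_sqrt_concave _ tau 4^-1 (2 * x) 0 x S q.
rewrite tau0 => /(_ _ _ _ _) h.
suff: 4^-1 * tau (2 * x) + (1 - 4^-1) * 0 <= tau x by lra.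
apply: h => //; nra.
Qed.

Lemma classS0_add (R : realType) (tau : R -> R) (u v : R) :
  classS0 tau -> 0 <= u -> 0 <= v -> tau (u + v) <= 2 * tau u + 2 * tau v.
Proof.
move=> S0 u0 v0; have [S _] := S0.
have q : 0 <= (2^-1 : R) <= 1 by lra.
have := @classS_convex _ tau 2^-1 (2 * u) (2 * v) S q.
have -> : 2^-1 * (2 * u) + (1 - 2^-1) * (2 * v) = u + v by field.
have := classS0_double S0 u0; have := classS0_double S0 v0.
move=> hv hu /(_ _ _) h.
suff : tau (u + v) <= 2^-1 * tau (2 * u) + (1 - 2^-1) * tau (2 * v) by lra.
apply: h; lra.
Qed.

(** The points [x + u] and [x + v] are convex combinations of [x] and
    [x + u + v] with complementary weights, so their sum only sees the sum of
    the end values.  Used with [D] the closed half line for [- tau] and with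
    [D] the open half line for [tau']. *)
Lemma outer_le_inner_of_concave (R : realFieldType) (D : R -> Prop) (g : R -> R)
    (x u v : R) :
  (forall t x y, 0 <= t <= 1 -> D x -> D y ->
     t * g x + (1 - t) * g y <= g (t * x + (1 - t) * y)) ->
  D x -> D (x + u + v) -> 0 <= u -> 0 <= v ->
  g x + g (x + u + v) <= g (x + u) + g (x + v).
Proof.
move=> cg Dx Dy u0 v0.
have [w0|w0] := leP (u + v) 0.
  have -> : u = 0 by lra.
  have -> : v = 0 by lra.
  by rewrite !addr0.
pose t := v / (u + v).
have tE : t * (u + v) = v by rewrite /t mulfVK // gt_eqF.
have t01 : 0 <= t <= 1 by rewrite divr_ge0 ?ler_pdivrMr; lra.
have t01' : 0 <= 1 - t <= 1 by lra.
have h1 := cg t _ _ t01 Dx Dy; have h2 := cg (1 - t) _ _ t01' Dx Dy.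
have e1 : t * x + (1 - t) * (x + u + v) = x + u by lra.
have e2 : (1 - t) * x + (1 - (1 - t)) * (x + u + v) = x + v by lra.
rewrite e1 in h1; rewrite e2 in h2; lra.
Qed.

Lemma classS_inner_le_outer (R : realType) (tau : R -> R) (x u v : R) :
  classS tau -> 0 <= x -> 0 <= u -> 0 <= v ->
  tau (x + u) + tau (x + v) <= tau x + tau (x + u + v).
Proof.
move=> S x0 u0 v0.
rewrite -lerN2 !opprD.
apply: (@outer_le_inner_of_concave _ (fun y => 0 <= y) (fun y => - tau y)) => //.
  by move=> t y z t01 y0 z0; have := classS_convex S t01 y0 z0; lra.
lra.
Qed.

(** The second difference of [tau] is nonincreasing in its base point, since its
    derivative is the second difference of the concave function [tau']. *)
Lemma classS_second_difference (R : realType) (tau : R -> R) (a b u v : R) :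
  classS tau -> 0 < a -> a <= b -> 0 <= u -> 0 <= v ->
  tau (b + u + v) + tau b - tau (b + u) - tau (b + v)
  <= tau (a + u + v) + tau a - tau (a + u) - tau (a + v).
Proof.
move=> S a0 ab u0 v0.
pose psi (x : R) := tau (x + u + v) + tau x - tau (x + u) - tau (x + v).
have shift (c x : R) : 0 <= c -> 0 < x ->
    is_derive x 1 (fun x : R => tau (x + c)) (derive1 tau (x + c)).
  move=> c0 x0; have xc0 : 0 < x + c by lra.
  have h := derivableP (classS_derivable S xc0).
  have h2 : is_derive x 1 (fun y : R => y + c) 1.
    by apply: is_derive_eq; rewrite addr0.
  by have := @is_derive1_comp _ tau (fun y => y + c) x _ _ h h2;
    rewrite mulr1 -derive1E.
have isd (x : R) : 0 < x -> is_derive x 1 psi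
   (derive1 tau (x + u + v) + derive1 tau x
    - derive1 tau (x + u) - derive1 tau (x + v)).
  move=> x0.
  have h1 : is_derive x 1 (fun x : R => tau (x + u + v)) (derive1 tau (x + u + v)).
    under eq_fun do rewrite -addrA; rewrite -addrA; apply: shift => //; lra.
  have h2 : is_derive x 1 tau (derive1 tau x).
    by rewrite derive1E; apply/derivableP/classS_derivable.
  have h3 := shift _ _ u0 x0; have h4 := shift _ _ v0 x0.
  exact: is_deriveB.
apply: (@nincr_on_pos _ psi) => // x.
  by move=> x0; case: (isd _ x0).
move=> /andP[ax _]; have x0 : 0 < x by lra.
rewrite (is_derive_derive1 (isd _ x0)).
have := @outer_le_inner_of_concave _ (fun y => 0 < y) (derive1 tau) x u v
  (fun t y z => @classS_derive_concave _ _ t y z S) x0.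
move=> /(_ _ u0 v0); rewrite (_ : 0 < x + u + v); last lra.
by move=> /(_ isT); lra.
Qed.

(** By [classS_second_difference] the worst base point is [x = 0], where the
    claim is [classS0_add].  The base point 0 is reached through small [e > 0];
    convexity bounds [tau e] and [tau (e + u + v)] there, which replaces the
    continuity of [tau] at 0. *)
Lemma classS0_outer_le_inner (R : realType) (tau : R -> R) (x u v : R) :
  classS0 tau -> 0 <= x -> 0 <= u -> 0 <= v ->
  tau x + tau (x + u + v) <= tau (x + u) + tau (x + v) + tau u + tau v.
Proof.
move=> S0 x0 u0 v0; have [S tau0] := S0.
have := classS0_add S0 u0 v0.
move: x0; rewrite le_eqVlt => /orP[/eqP<-|x0 huv].
  by rewrite tau0 !add0r; lra.
suff : tau (x + u + v) + tau x - tau (x + u) - tau (x + v)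
       <= tau (u + v) - tau u - tau v by lra.
apply: (@le_of_small_slack _ _ _ (tau 1 + (tau (u + v + 1) - tau (u + v)))
  (Num.min x 1)); first by rewrite lt_min x0 ltr01.
move=> e e0; rewrite lt_min => /andP[ex e1].
apply: le_trans (classS_second_difference S e0 (ltW ex) u0 v0) _.
have e01 : 0 <= e <= 1 by lra.
have uv0 : 0 <= u + v by lra.
have h1 : tau e <= e * tau 1.
  have := @classS_convex _ _ e 1 0 S e01 ler01 (lexx 0).
  by rewrite tau0 !mulr0 !addr0 mulr1.
have h2 : tau (e + u + v) <= e * tau (u + v + 1) + (1 - e) * tau (u + v).
  rewrite (_ : e + u + v = e * (u + v + 1) + (1 - e) * (u + v)); last by ring.
  by apply: classS_convex => //; lra.
have h3 : tau u <= tau (e + u) by apply: classS_le => //; lra.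
have h4 : tau v <= tau (e + v) by apply: classS_le => //; lra.
lra.
Qed.

(** * Four points on the real line *)

Lemma four_point_line_sorted (R : realType) (tau : R -> R) (y q p z : R) :
  classS0 tau -> y <= q -> p <= z -> y <= p ->
  tau `|y - q| + tau `|p - z|
  <= tau `|y - p| + tau `|q - p| + tau `|y - z| + tau `|q - z|.
Proof.
move=> S0 yq pz yp; have [S tau0] := S0.
have tge0 (x : R) : 0 <= tau `|x| by rewrite -tau0 classS_le.
have N (a b : R) : a <= b -> `|a - b| = b - a.
  by move=> ab; rewrite distrC ger0_norm // subr_ge0.
rewrite (N y q) // (N p z) // (N y p) // (N y z); last lra.
(* The three cases are disjoint, partially overlapping and nested diagonals. *)
have [qp|/ltW pq] := leP q p.
  have := tge0 (q - p); have := tge0 (q - z).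
  have : tau (q - y) <= tau (p - y) by apply: classS_le => //; lra.
  have : tau (z - p) <= tau (z - y) by apply: classS_le => //; lra.
  lra.
rewrite (distrC q p) (N p q) //.
have [qz|/ltW zq] := leP q z.
  rewrite (N q z) //.
  have : 0 <= tau (p - y) by rewrite -(N y p)//; apply: tge0.
  have : 0 <= tau (z - q) by rewrite -(N q z)//; apply: tge0.
  have := @classS_inner_le_outer _ _ (q - p) (p - y) (z - q) S.
  rewrite !subr_ge0 => /(_ pq yp qz).
  have -> : q - p + (p - y) = q - y by ring.
  have -> : q - p + (z - q) = z - p by ring.
  have -> : q - y + (z - q) = z - y by ring.
  lra.
rewrite (distrC q z) (N z q) //.
have := @classS0_outer_le_inner _ _ (z - p) (p - y) (q - z) S0.
rewrite !subr_ge0 => /(_ pz yp zq).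
have -> : z - p + (p - y) = z - y by ring.
have -> : z - p + (q - z) = q - p by ring.
have -> : z - y + (q - z) = q - y by ring.
lra.
Qed.

Lemma four_point_line (R : realType) (tau : R -> R) (y q p z : R) :
  classS0 tau ->
  tau `|y - q| + tau `|p - z|
  <= tau `|y - p| + tau `|q - p| + tau `|y - z| + tau `|q - z|.
Proof.
move=> S0.
wlog yq : y q / y <= q.
  move=> W; have [/W//|/ltW/W] := leP y q.
  by rewrite (distrC q y); lra.
wlog pz : p z / p <= z.
  move=> W; have [/W//|/ltW/W] := leP p z.
  by rewrite (distrC z p); lra.
have [yp|/ltW py] := leP y p; first exact: four_point_line_sorted.
have := four_point_line_sorted S0 pz yq py.
rewrite (distrC p y) (distrC p q) (distrC z y) (distrC z q); lra.
Qed.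

(** * Reduction of the general case to the line *)

Lemma discriminant_le (R : realFieldType) (m c n : R) :
  0 <= m -> (forall x, 0 <= m * x ^+ 2 + 2 * c * x + n) -> c ^+ 2 <= m * n.
Proof.
rewrite le_eqVlt => /orP[/eqP<-|m0] H.
  have [->|c0] := eqVneq c 0; first by rewrite mul0r expr0n.
  (* An affine function with nonzero slope takes the value -1. *)
  have := H (- (n + 1) / (2 * c)).
  have -> : 0 * (- (n + 1) / (2 * c)) ^+ 2 + 2 * c * (- (n + 1) / (2 * c)) + n = -1.
    by field.
  by rewrite oppr_ge0 ler10.
have := H (- c / m); rewrite -(pmulr_rge0 _ m0).
have -> : m * (m * (- c / m) ^+ 2 + 2 * c * (- c / m) + n) = m * n - c ^+ 2.
  by field; rewrite gt_eqF.
by rewrite subr_ge0.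
Qed.

(** The squared norm of [x1 w + x2 D1 + x3 D2] in terms of the Gram matrix of
    [w], [D1], [D2].  Working with Gram matrices treats real and complex scalars
    alike, as only real combinations of three vectors and the real part of the
    inner product matter. *)
Definition gram3 (R : realType) (ww d11 d22 c1 c2 g x1 x2 x3 : R) : R :=
  ww * x1 ^+ 2 + d11 * x2 ^+ 2 + d22 * x3 ^+ 2
  + 2 * (c1 * (x1 * x2) + c2 * (x1 * x3) + g * (x2 * x3)).

(** The normal equations for the common perpendicular of two lines with
    directions [D1], [D2] whose base points differ by [w]:
    [w - s D1 + t D2] is orthogonal to [D1] and [D2].  They are solvable even
    when the lines are parallel or degenerate to points, because nonnegativity
    of the form makes the right-hand side vanish wherever the Gram matrix of
    [D1], [D2] does. *)
Lemma closest_points (R : realType) (ww d11 d22 c1 c2 g : R) :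
  (forall x1 x2 x3, 0 <= gram3 ww d11 d22 c1 c2 g x1 x2 x3) ->
  exists s t, s * d11 - t * g = c1 /\ s * g - t * d22 = c2.
Proof.
rewrite /gram3 => P.
have d1 : 0 <= d11 by have := P 0 1 0; lra.
have d2 : 0 <= d22 by have := P 0 0 1; lra.
have C1 : c1 ^+ 2 <= d11 * ww.
  by apply: discriminant_le => // x; have := P 1 x 0; lra.
have C2 : c2 ^+ 2 <= d22 * ww.
  by apply: discriminant_le => // x; have := P 1 0 x; lra.
have G : g ^+ 2 <= d11 * d22.
  by apply: discriminant_le => // x; have := P 0 x 1; lra.
have sq0 (x : R) : x ^+ 2 <= 0 -> x = 0.
  by move=> h; apply/eqP; rewrite -sqrf_eq0 eq_le h sqr_ge0.
have [D0|D0] := eqVneq (d11 * d22 - g ^+ 2) 0; last first.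
  exists ((c1 * d22 - c2 * g) / (d11 * d22 - g ^+ 2)).
  exists ((c1 * g - c2 * d11) / (d11 * d22 - g ^+ 2)).
  by split; field.
have [d10|d10] := eqVneq d11 0.
  have g0 : g = 0 by apply: sq0; rewrite (le_trans G)// d10 mul0r.
  have c10 : c1 = 0 by apply: sq0; rewrite (le_trans C1)// d10 mul0r.
  have [d20|d20] := eqVneq d22 0.
    have c20 : c2 = 0 by apply: sq0; rewrite (le_trans C2)// d20 mul0r.
    by exists 0, 0; rewrite c10 c20 !mul0r subr0.
  by exists 0, (- c2 / d22); rewrite d10 g0 c10; split; field.
exists (c1 / d11), 0; split; first by field.
(* The vector d11 D2 - g D1 has squared norm d11 (d11 d22 - g^2) = 0, so its
   inner product with w vanishes too. *)
have : d11 * c2 - g * c1 = 0.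
  apply: sq0; rewrite -[leRHS](mul0r ww).
  apply: discriminant_le => // x.
  have := P 1 (- g * x) (d11 * x).
  have -> : ww * 1 ^+ 2 + d11 * (- g * x) ^+ 2 + d22 * (d11 * x) ^+ 2 +
    2 * (c1 * (1 * (- g * x)) + c2 * (1 * (d11 * x)) +
         g * (- g * x * (d11 * x))) =
    d11 * (d11 * d22 - g ^+ 2) * x ^+ 2 + 2 * (d11 * c2 - g * c1) * x + ww by ring.
  by rewrite D0 mulr0.
move=> h; apply: (mulfI d10).
have -> : d11 * (c1 / d11 * g - 0 * d22) = g * c1 by field.
lra.
Qed.

(** Here [w = y - p], [D1 = y - q] and [D2 = p - z], so [D1] and [D2] are the
    diagonals and the four terms on the right are the sides [yp], [qp], [yz],
    [qz]. *)
Lemma four_point_gram (R : realType) (tau : R -> R) (ww d11 d22 c1 c2 g : R) :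
  classS0 tau ->
  (forall x1 x2 x3, 0 <= gram3 ww d11 d22 c1 c2 g x1 x2 x3) ->
  forall N : R -> R -> R -> R,
  (forall x1 x2 x3, N x1 x2 x3 = Num.sqrt (gram3 ww d11 d22 c1 c2 g x1 x2 x3)) ->
  tau (N 0 1 0) + tau (N 0 0 1)
  <= tau (N 1 0 0) + tau (N 1 (-1) 0) + tau (N 1 0 1) + tau (N 1 (-1) 1).
Proof.
move=> S0 P N NE; have [S _] := S0.
have [s [t [E1 E2]]] := closest_points P.
pose a := Num.sqrt d11; pose e := Num.sqrt d22.
have d1 : 0 <= d11 by have := P 0 1 0; rewrite /gram3; lra.
have d2 : 0 <= d22 by have := P 0 0 1; rewrite /gram3; lra.
have a0 : 0 <= a := sqrtr_ge0 _; have e0 : 0 <= e := sqrtr_ge0 _.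
have aE : a ^+ 2 = d11 := sqr_sqrtr d1.
have eE : e ^+ 2 = d22 := sqr_sqrtr d2.
have G : `|g| <= a * e.
  rewrite -ler_sqr ?nnegrE ?mulr_ge0// real_normK ?num_real// exprMn aE eE.
  by apply: discriminant_le => // x; have := P 0 x 1; rewrite /gram3; lra.
(* By Cauchy-Schwarz g is a convex combination of the two extreme values
   that correspond to parallel diagonals. *)
have [l l01 gE] : exists2 l, 0 <= l <= 1 & g = l * (a * e) + (1 - l) * - (a * e).
  move: G; rewrite ler_norml => /andP[G1 G2].
  have [ae0|ae0] := eqVneq (a * e) 0.
    by exists 0; rewrite ?lexx ?ler01//; lra.
  have ae1 : 0 < a * e by rewrite lt_def ae0 mulr_ge0.
  exists ((1 + g / (a * e)) / 2); last by field; rewrite -negb_or orbC -mulf_eq0.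
  have : -1 <= g / (a * e) <= 1 by rewrite ler_pdivlMr ?ler_pdivrMr; lra.
  lra.
(* Each side is compared with its two collinear positions.  The squared length
   of the common perpendicular, gram3 at (1, - s, t), is dropped. *)
have side m n x2 x3 : x2 = m - s -> x3 = t - n ->
    l * tau `|m * a - n * e| + (1 - l) * tau `|m * a + n * e| <= tau (N 1 x2 x3).
  move=> -> ->; apply: classS_sqrt_concave => //; first by rewrite NE sqrtr_ge0.
  rewrite NE sqr_sqrtr // !real_normK ?num_real//.
  have h : gram3 ww d11 d22 c1 c2 g 1 (m - s) (t - n) =
      gram3 ww d11 d22 c1 c2 g 1 (- s) t
      + (m ^+ 2 * a ^+ 2 + n ^+ 2 * e ^+ 2 - 2 * m * n * g).
    by rewrite /gram3 aE eE -E1 -E2; ring.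
  rewrite h; have := P 1 (- s) t; set r := gram3 _ _ _ _ _ _ _ _ _.
  rewrite gE; lra.
have N1 : N 0 1 0 = a by rewrite NE /gram3 /a; congr Num.sqrt; ring.
have N2 : N 0 0 1 = e by rewrite NE /gram3 /e; congr Num.sqrt; ring.
rewrite N1 N2.
have H1 := side s t 0 0; have H2 := side (s - 1) t (-1) 0.
have H3 := side s (t - 1) 0 1; have H4 := side (s - 1) (t - 1) (-1) 1.
have {}H1 := H1 ltac:(ring) ltac:(ring).
have {}H2 := H2 ltac:(ring) ltac:(ring).
have {}H3 := H3 ltac:(ring) ltac:(ring).
have {}H4 := H4 ltac:(ring) ltac:(ring).
have L1 := four_point_line (s * a) ((s - 1) * a) (t * e) ((t - 1) * e) S0.
have L2 := four_point_line (s * a) ((s - 1) * a) (- (t * e)) (- ((t - 1) * e)) S0.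
rewrite !opprK in L2.
have A1 : `|s * a - (s - 1) * a| = a by rewrite -[RHS]ger0_norm//; congr `|_|; ring.
have B1 : `|t * e - (t - 1) * e| = e by rewrite -[RHS]ger0_norm//; congr `|_|; ring.
have B2 : `|- (t * e) + (t - 1) * e| = e.
  by rewrite -normrN -[RHS]ger0_norm//; congr `|_|; ring.
rewrite A1 B1 in L1; rewrite A1 B2 in L2.
move: l01 => /andP[l0 l1].
have := lerD (ler_wpM2l l0 L1) (@ler_wpM2l _ (1 - l) _ _ _ L2).
rewrite subr_ge0 l1 => /(_ isT).
lra.
Qed.

(** [B] stands for the real part of an inner product and [sc] for the scaling by
    real numbers, so that this covers both choices of the scalar field. *)
Lemma four_point_form (R : realType) (tau : R -> R) (V : zmodType)
    (B : V -> V -> R) (sc : R -> V -> V) :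
  classS0 tau ->
  (forall u v, B u v = B v u) ->
  (forall u v w, B (u + v) w = B u w + B v w) ->
  (forall k u v, B (sc k u) v = k * B u v) ->
  (forall u, 0 <= B u u) ->
  forall d : V -> V -> R, (forall u v, d u v = Num.sqrt (B (u - v) (u - v))) ->
  forall y z q p,
  tau (d y q) - tau (d y p) - tau (d z q) + tau (d z p)
    <= tau (d q p) + tau (d y z).
Proof.
move=> S0 Bsym BD BZ Bge0 d dB y z q p.
(* Opaque names: the additivity rules below must not expand w, D1, D2. *)
have [w wE] : exists w, w = y - p by exists (y - p).
have [D1 D1E] : exists D1, D1 = y - q by exists (y - q).
have [D2 D2E] : exists D2, D2 = p - z by exists (p - z).
have BDr u v v' : B u (v + v') = B u v + B u v' by rewrite Bsym BD !(Bsym u).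
have BZr k u v : B u (sc k v) = k * B u v by rewrite Bsym BZ Bsym.
have BNr u v : B u (- v) = - B u v.
  have B0 : B u 0 = 0 by have := BDr u 0 0; rewrite addr0; lra.
  by have := BDr u v (- v); rewrite subrr B0; lra.
have BN u v : B (- u) v = - B u v by rewrite Bsym BNr Bsym.
have P x1 x2 x3 :
    0 <= gram3 (B w w) (B D1 D1) (B D2 D2) (B w D1) (B w D2) (B D1 D2) x1 x2 x3.
  have := Bge0 (sc x1 w + sc x2 D1 + sc x3 D2).
  rewrite !(BD, BDr, BZ, BZr, Bsym D1 w, Bsym D2 w, Bsym D2 D1) /gram3; lra.
have dN u v : d u v = d v u.
  by rewrite !dB -(opprB v u) BN BNr opprK.
pose N x1 x2 x3 := Num.sqrt
  (gram3 (B w w) (B D1 D1) (B D2 D2) (B w D1) (B w D2) (B D1 D2) x1 x2 x3).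
have := four_point_gram S0 P (fun x1 x2 x3 => erefl (N x1 x2 x3)).
have dE u v x1 x2 x3 (X : V) : u - v = X ->
    B X X = gram3 (B w w) (B D1 D1) (B D2 D2) (B w D1) (B w D2) (B D1 D2) x1 x2 x3 ->
    d u v = N x1 x2 x3.
  by move=> uv BE; rewrite dB /N uv BE.
have ex := (BD, BDr, BN, BNr, Bsym D1 w, Bsym D2 w, Bsym D2 D1).
have <- : d y q = N 0 1 0 by apply: (dE _ _ _ _ _ D1) => //; rewrite /gram3; ring.
have <- : d p z = N 0 0 1 by apply: (dE _ _ _ _ _ D2) => //; rewrite /gram3; ring.
have <- : d y p = N 1 0 0 by apply: (dE _ _ _ _ _ w) => //; rewrite /gram3; ring.
have <- : d q p = N 1 (-1) 0.
  apply: (dE _ _ _ _ _ (w - D1)); last by rewrite !ex /gram3; ring.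
  by rewrite wE D1E opprB [RHS]addrC addrA subrK.
have <- : d y z = N 1 0 1.
  apply: (dE _ _ _ _ _ (w + D2)); last by rewrite !ex /gram3; ring.
  by rewrite wE D2E addrA subrK.
have <- : d q z = N 1 (-1) 1.
  apply: (dE _ _ _ _ _ (w - D1 + D2)); last by rewrite !ex /gram3; ring.
  by rewrite wE D1E D2E opprB [y - p + _]addrC !addrA !subrK.
rewrite (dN z q) (dN z p); lra.
Qed.

Theorem theorem3 (R : realType) (tau : R -> R) (Htau : classS0 tau) :
  (forall (V : lmodType R) (dot : {dot V for (@idfun R)}) (y z q p : V),
     let d := dot_dist (@idfun R) dot in
     tau (d y q) - tau (d y p) - tau (d z q) + tau (d z p)
       <= tau (d q p) + tau (d y z))
  /\
  (forall (V : lmodType R[i]) (dot : {dot V for (@conjc R)})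
          (y z q p : V),
     let d := dot_dist (@complex.Re R) dot in
     tau (d y q) - tau (d y p) - tau (d z q) + tau (d z p)
       <= tau (d q p) + tau (d y z)).
Proof.
split=> V dot y z q p /=.
  apply: (@four_point_form _ _ _ (fun u v => dot u v) (fun k u => k *: u)) => //.
  - by move=> u v; rewrite hermitian_subproof expr0 mul1r.
  - by move=> u v w; rewrite linearDl.
  - by move=> k u v; rewrite linearZl_LR.
  - move=> u; have [->|u0] := eqVneq u 0; first by rewrite linear0r.
    by apply: ltW; apply: neq0_dnorm_gt0.
have Re_conj (x : R[i]) : complex.Re (conjc x) = complex.Re x by case: x.
have ReD (x x' : R[i]) : complex.Re (x + x') = complex.Re x + complex.Re x'.
  by case: x => ? ?; case: x'.
have ReZ (k : R) (x : R[i]) : complex.Re (k%:C%C * x) = k * complex.Re x.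
  by case: x => a b /=; rewrite mul0r subr0.
have Re_ge0 (x : R[i]) : 0 < x -> 0 <= complex.Re x.
  by case: x => a b; rewrite ltcE /= => /andP[_ /ltW].
apply: (@four_point_form _ _ _ (fun u v => complex.Re (dot u v))
   (fun k u => k%:C%C *: u)) => //.
- move=> u v; rewrite hermitian_subproof expr0 mul1r; exact: Re_conj.
- move=> u v w; rewrite linearDl; exact: ReD.
- move=> k u v; rewrite linearZl_LR; exact: ReZ.
- move=> u; have [->|u0] := eqVneq u 0; first by rewrite linear0r.
  exact/Re_ge0/neq0_dnorm_gt0.
Qed.
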